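(* The function $\psi(u,t)=\mathbf{P}(\tau_u<t)$ satisfies the Fredholm type equation $$\psi(u,t)=\psi_0(u,t)+\mathcal{K}\psi(u,t),\qquad (u,t)\in(0,\infty)^2,$$ where $\psi_0(u,t)=\mathbf{P}\big(W\ge \tfrac uc\big)\,I_{\{t>u/c\}}$.
   Context: Let $c>0$ be a constant. Let $(W_i,X_i)$, $i=1,2,\dots$, be independent and identically distributed random vectors with the law of $(W,X)$, where $W\ge 0$ and $X>0$ ($W_i$ and $X_i$ may be dependent on each other). Put $T_0=0$, $T_n=W_1+\dots+W_n$. The cash flow process is $$U_t=c\sum_{n=0}^\infty 1_{[T_n,T_{n+1})}(t)\Big\{(t-T_n)e^{-\sum_{i=1}^nX_i}+\sum_{i=1}^n(T_i-T_{i-1})e^{-\sum_{k=1}^{i-1}X_k}\Big\},\quad t\ge 0,$$ with empty sums equal to $0$. For $u>0$ let $\tau_u$ be the first hitting time of level $u$ by $U$ (with $\tau_u=\infty$ if $u$ is never reached). The finite-time probability of full loan repayment is $\psi(u,t)=\mathbf{P}(\tau_u<t)$. For a bounded measurable function $h$ on $(0,\infty)^2$, $$\mathcal{K}h(u,t)=\mathbf{E}\big[I_{\{W<t\wedge\frac uc\}}\,h(e^X(u-cW),\,t-W)\big].$$ *)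

(* Defs.v *)
From mathcomp Require Import all_boot all_order all_algebra finmap.
From mathcomp Require Import all_classical all_reals all_analysis.

Set Implicit Arguments.
Unset Strict Implicit.
Unset Printing Implicit Defensive.

Import Order.TTheory GRing.Theory Num.Theory.
Import numFieldNormedType.Exports.

Local Open Scope classical_set_scope.
Local Open Scope ring_scope.

(* The plane with the product of the Borel sigma-algebras *)
Notation plane R := (measurableTypeR R * measurableTypeR R)%type.

Section iid.
Context (d d' : measure_display) (T : measurableType d)
  (T' : measurableType d') (R : realType) (P : probability T R).

Definition mutually_independent (Z : nat -> {RV P >-> T'}) : Prop :=
  forall (I : {fset nat}) (B : nat -> set T'),
    (forall i, measurable (B i)) ->
    P (\bigcap_(i in [set` I]) (Z i @^-1` B i)) =
    (\prod_(i <- I) P (Z i @^-1` B i))%E.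

Definition same_law (Y Y' : {RV P >-> T'}) : Prop :=
  forall B, measurable B -> distribution P Y B = distribution P Y' B.

Definition iid_copies (Y : {RV P >-> T'}) (Z : nat -> {RV P >-> T'}) : Prop :=
  mutually_independent Z /\ forall i, same_law (Z i) Y.

End iid.

Section repayment.
Context (d : measure_display) (T : measurableType d) (R : realType)
  (P : probability T R).

(* The sequence is indexed from 0: Z i is the random vector
   (W_{i+1}, X_{i+1}). *)
Section process.
Variables (c : R) (Z : nat -> {RV P >-> plane R}).

(* T_n = W_1 + ... + W_n *)
Definition renewal_time (n : nat) (w : T) : R := \sum_(i < n) (Z i w).1.

(* exp (- (X_1 + ... + X_n)) *)
Definition discount (n : nat) (w : T) : R := expR (- \sum_(i < n) (Z i w).2).

(* For nonnegative W_i the intervals [T_n, T_{n+1}) are pairwise disjoint, so at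
   most one term of the series is nonzero; if t lies in none of them (T_n has a
   finite limit, and t is beyond it), then U_t = 0. *)
Definition cash_flow (t : R) (w : T) : R :=
  c * limn (series (fun n =>
    \1_`[renewal_time n w, renewal_time n.+1 w[ t *
    ((t - renewal_time n w) * discount n w +
     \sum_(i < n) (renewal_time i.+1 w - renewal_time i w) * discount i w))).

(* First hitting time of the level u; the infimum of the empty set is +oo. *)
Definition hitting_time (u : R) (w : T) : \bar R :=
  ereal_inf [set t%:E | t in [set t | 0 <= t /\ cash_flow t w = u]].

Definition psi (u t : R) : R :=
  fine (P [set w | (hitting_time u w < t%:E)%E]).

End process.

Section equation.
Variables (c : R) (WX : {RV P >-> plane R}).

Definition psi0 (u t : R) : R :=
  fine (P [set w | u / c <= (WX w).1]) * (u / c < t)%R%:R.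

Definition Kop (h : R -> R -> R) (u t : R) : \bar R :=
  'E_P[fun w => ((WX w).1 < Num.min t (u / c))%R%:R *
                h (expR (WX w).2 * (u - c * (WX w).1)) (t - (WX w).1)].

End equation.

End repayment.

(* The class of functions on (0, oo)^2 on which the operator Kop acts *)
Definition bounded_measurable (R : realType) (h : R -> R -> R) : Prop :=
  measurable_fun ((`]0, +oo[ `*` `]0, +oo[) : set (plane R))
    (fun p => h p.1 p.2 : measurableTypeR R) /\
  exists M : R, forall u t, 0 < u -> 0 < t -> `|h u t| <= M.

(* Main.v *)
From HB Require Import structures.
Require Import Defs.
From mathcomp Require Import all_boot all_order all_algebra finmap.
From mathcomp Require Import all_classical all_reals all_analysis.
From mathcomp Require Import measurable_realfun ring.

(** The equation is a first-step decomposition: condition on the first vector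
    [(W_1, X_1)] and use that the remaining sequence is an independent copy of
    the whole one.

    Pathwise, put [T_n = W_1 + ... + W_n], [D_n = exp (- (X_1 + ... + X_n))] and
    [A_n = W_1 D_0 + ... + W_n D_(n-1)], so that [U_(T_n) = c A_n] and [U] grows
    at rate [c D_n] on [[T_n, T_(n+1))].  With [v = u / c], the level [u > 0] is
    reached on that interval exactly when [A_n <= v < A_(n+1)], and then at time
    [T_n + (v - A_n) / D_n]; hence [tau_u < t] is a countable disjunction of
    inequalities between partial sums ([reaches], [hitting_timeP]).  This makes
    it an event, jointly measurable in the path and in [(u, t)], whence the
    measurability of [psi].  Removing the first vector from the path
    turns these inequalities into those of the shifted path at
    [(exp X_1 (v - W_1), t - W_1)] as soon as [W_1 <= v]
    ([reaches_scons_next]), while for [W_1 > v] the loan is repaid at time [v],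
    during the first interval ([reaches_scons_first]).

    The probabilistic input is [law_scons]: the law of an i.i.d. sequence is the
    image of the product of the law of one term and of itself under
    prepending.  Both measures agree on cylinders, which are stable under
    intersection and generate the sigma-algebra.

    One boundary case remains, [W_1 = v].  The level is then attained at time
    [v] only if some later [W_i] is nonzero: if all of them vanish, the clock
    stops at [T_1 = v] and no half-open interval contains that instant.  This
    failure is negligible.  By [law_scons] the probability [q] that all the
    [W_i] vanish satisfies [q = q P(W = 0)], so either [q = 0], or [W = 0]
    almost surely and [W = v > 0] does not occur ([ae_never_moves]). *)

Import Order.TTheory GRing.Theory Num.Theory.
Import numFieldNormedType.Exports.

Local Open Scope classical_set_scope.
Local Open Scope ring_scope.

(** * The space of sequences and the law of an i.i.d. sequence *)

Section sequence_space.
Context {de : measure_display} {E : measurableType de}.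

Definition box (B : nat -> set E) : set (nat -> E) :=
  [set z | forall i, B i (z i)].

(** The finiteness condition is put on the family of factors rather than on an
    index set, so that prepending a term only shifts the family. *)
Definition cylinders : set (set (nat -> E)) :=
  [set box B | B in [set B | (forall i, measurable (B i)) /\
                             exists n, forall i, (n <= i)%N -> B i = setT]].

Definition seqspace : Type := g_sigma_algebraType cylinders.
HB.instance Definition _ := Measurable.on seqspace.

Definition scons (x : E) (z : nat -> E) : nat -> E :=
  fun i => if i is j.+1 then z j else x.

Lemma setI_closed_cylinders : setI_closed cylinders.
Proof.
move=> _ _ [B [mB [n nB]] <-] [C [mC [m mC']] <-].
exists (fun i => B i `&` C i).
  split=> [i|]; first exact: measurableI.
  exists (maxn n m) => i; rewrite geq_max => /andP[ni mi].
  by rewrite nB// mC'// setIT.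
apply/seteqP; split=> [z BCz|z [Bz Cz] i]; last by split.
by split=> i; have [] := BCz i.
Qed.

Lemma cylindersT : cylinders setT.
Proof.
exists (fun=> setT); first by split=> //; exists 0%N.
by apply/seteqP; split.
Qed.

Lemma measurable_fun_coord i : measurable_fun setT (fun z : seqspace => z i).
Proof.
move=> _ Y mY; rewrite setTI; apply: sub_sigma_algebra.
exists (fun j => if j == i then Y else setT).
  split=> [j|]; first by case: ifP.
  by exists i.+1 => j ij; rewrite gtn_eqF.
apply/seteqP; split=> [z /(_ i)|z Yz j]; first by rewrite eqxx.
by case: ifPn => // /eqP ->.
Qed.

Lemma measurable_fun_seqspace d (T : measurableType d) (f : T -> seqspace) :
  (forall i, measurable_fun setT (fun w => f w i)) -> measurable_fun setT f.
Proof.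
move=> mf; apply: (@measurability _ _ T seqspace _ _ cylinders) => //.
move=> _ [_ [B [mB _] <-] <-]; rewrite setTI.
rewrite (_ : _ @^-1` _ = \bigcap_i ((fun w => f w i) @^-1` B i)).
  apply: bigcapT_measurable => i; rewrite -[X in measurable X]setTI.
  exact: mf.
by apply/seteqP; split=> [w Bw i _|w Bw i]; [exact: Bw|exact: (Bw i I)].
Qed.

Lemma measurable_scons :
  measurable_fun setT (fun p : E * seqspace => scons p.1 p.2 : seqspace).
Proof.
apply: measurable_fun_seqspace => -[|i] /=; first exact: measurable_fst.
apply: (measurableT_comp (measurable_fun_coord i)); exact: measurable_snd.
Qed.

End sequence_space.
Arguments cylinders {de} E.
Arguments seqspace {de} E.

Section iid_law.
Context {d de : measure_display} {T : measurableType d} {E : measurableType de}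
  {R : realType} {P : probability T R} {Y : {RV P >-> E}}
  (Z : nat -> {RV P >-> E}).

Definition trajectory (w : T) : seqspace E := fun i => Z i w.

Lemma measurable_trajectory : measurable_fun setT trajectory.
Proof. by apply: measurable_fun_seqspace => i; exact: measurable_funPT. Qed.

HB.instance Definition _ :=
  @isMeasurableFun.Build _ _ T (seqspace E) trajectory measurable_trajectory.

Local Notation mu := (distribution P Y).
Local Notation nu := (distribution P trajectory).

Lemma measurable_law_scons (A : set (seqspace E)) : measurable A ->
  measurable_fun setT (fun x => nu [set z | A (scons x z)]).
Proof.
move=> mA.
pose F (p : E * seqspace E) : seqspace E := scons p.1 p.2.
have mFA : measurable (F @^-1` A).
  by rewrite -[X in measurable X]setTI; exact: measurable_scons.
apply: eq_measurable_fun (measurable_fun_xsection nu mFA) => x _ /=.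
by congr (nu _); apply/seteqP; split=> z; rewrite /xsection/= inE.
Qed.

Hypothesis iid : iid_copies Y Z.

(** The length [n] only has to bound the number of constrained factors, which
    lets the bound grow by one when a term is prepended. *)
Lemma law_box (B : nat -> set E) n : (forall i, measurable (B i)) ->
  (forall i, (n <= i)%N -> B i = setT) ->
  nu (box B) = (\prod_(i < n) mu (B i))%E.
Proof.
move=> mB nB; have [ind law] := iid.
transitivity
    (P (\bigcap_(i in [set` [fset i in iota 0 n]%fset]) (Z i @^-1` B i))).
  congr (P _); apply/seteqP; split=> w Bw i.
    by move=> _; exact: Bw.
  have [ni|ni] := leqP n i; first by rewrite nB.
  by apply: Bw; rewrite /= !inE mem_iota.
rewrite ind// (perm_big (index_iota 0 n)).
  by rewrite big_mkord; apply: eq_bigr => i _; exact: law.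
apply: uniq_perm; [exact: fset_uniq|exact: iota_uniq|].
by move=> i; rewrite !inE /index_iota subn0.
Qed.

(** An i.i.d. sequence is stationary under prepending an independent term: the
    first term can be integrated out, what follows it having the law of the
    whole sequence. *)
Lemma law_scons (A : set (seqspace E)) : measurable A ->
  nu A = (\int[P]_w nu [set z | A (scons (Y w) z)])%E.
Proof.
pose F (p : E * seqspace E) : seqspace E := scons p.1 p.2.
have mF : measurable_fun setT F by exact: measurable_scons.
pose m2 : {measure set (seqspace E) -> \bar R} :=
  Measure.clone _ _ _ (pushforward (mu \x nu)%E F) (_ mF).
move=> mA; transitivity (m2 A).
  apply: (@measure_unique _ R (seqspace E) (cylinders E) (fun=> setT) _ _ _ _
    nu m2) => //.
  - exact: setI_closed_cylinders.
  - by move=> _; exact: cylindersT.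
  - by apply/seteqP; split=> // z _; exists 0%N.
  - move=> _ [B [mB [n nB]] <-].
    apply: (etrans (@law_box B n.+1 mB _)); first by move=> i /ltnW; exact: nB.
    (* the preimage of a cylinder is a rectangle over a cylinder *)
    transitivity ((mu \x nu)%E (F @^-1` box B)) => //.
    rewrite (_ : F @^-1` box B = B 0%N `*` box (fun i => B i.+1)); last first.
      apply/seteqP; split=> [[x z] Bz|[x z] [/= Bx Bz] i].
        by split=> [|i]; [exact: (Bz 0%N)|exact: (Bz i.+1)].
      by case: i => [|i]; [exact: Bx|exact: Bz].
    rewrite product_measure1E//.
      rewrite big_ord_recl/=; congr (_ * _)%E.
      rewrite (@law_box (fun i => B i.+1) n)// => i ni.
      by rewrite nB// leqW.
    apply: sub_sigma_algebra; exists (fun i => B i.+1) => //; split=> //.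
    by exists n => i ni; rewrite nB// leqW.
  - move=> _; apply: (@le_lt_trans _ _ 1%E); last exact: ltry.
    exact: probability_le1.
transitivity (\int[mu]_x (nu \o xsection (F @^-1` A)) x)%E => //.
transitivity (\int[mu]_x nu [set z | A (scons x z)])%E.
  apply: eq_integral => x _ /=; congr (nu _).
  by apply/seteqP; split=> z; rewrite /xsection/= inE.
by rewrite ge0_integral_distribution//; exact: measurable_law_scons.
Qed.

End iid_law.

(** * Repayment along one path *)

Lemma limn_series_single (R : realType) (f : nat -> R) n :
  (forall k, k != n -> f k = 0) -> limn (series f) = f n.
Proof.
move=> f0; apply/cvg_lim => //; apply: cvg_near_cst.
near=> m; apply/eqP; rewrite /series/= (bigD1_seq n)//= ?iota_uniq//.
  by rewrite big1 ?addr0// => i; exact: f0.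
by rewrite mem_index_iota/=; near: m; exact: nbhs_infty_gt.
Unshelve. all: by end_near. Qed.

Section paths.
Context {R : realType}.
Implicit Types (z : nat -> plane R) (v s t : R) (n : nat).

Definition epoch z n : R := \sum_(i < n) (z i).1.
Definition disc z n : R := expR (- \sum_(i < n) (z i).2).
(** The cash flow at the [n]-th epoch for unit rate [c = 1]. *)
Definition repaid z n : R := \sum_(i < n) (z i).1 * disc z i.

(** The affine function growing from [repaid z n] with slope [disc z n] takes the
    value [v] inside the [n]-th interval, at a time smaller than [t]. *)
Definition reaches z v t : Prop :=
  exists n, repaid z n <= v < repaid z n.+1 /\
            epoch z n + (v - repaid z n) / disc z n < t.

Definition nonneg z : Prop := forall i, 0 <= (z i).1.

Lemma disc_gt0 z n : 0 < disc z n. Proof. exact: expR_gt0. Qed.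

Lemma epochS z n : epoch z n.+1 = epoch z n + (z n).1.
Proof. exact: big_ord_recr. Qed.

Lemma repaidS z n : repaid z n.+1 = repaid z n + (z n).1 * disc z n.
Proof. exact: big_ord_recr. Qed.

Lemma epoch_ge0 z n : nonneg z -> 0 <= epoch z n.
Proof. by move=> z0; apply: sumr_ge0. Qed.

Lemma repaid_ge0 z n : nonneg z -> 0 <= repaid z n.
Proof.
by move=> z0; apply: sumr_ge0 => i _; rewrite mulr_ge0// ltW// disc_gt0.
Qed.

Lemma epoch_nd z : nonneg z -> {homo epoch z : m n / (m <= n)%N >-> m <= n}.
Proof.
move=> z0; apply: homo_leq => [//|? ? ?|n]; first exact: le_trans.
by rewrite epochS lerDl.
Qed.

Section scons.
Variables (x : plane R) (z : nat -> plane R).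

Lemma epoch_scons n : epoch (scons x z) n.+1 = x.1 + epoch z n.
Proof. exact: big_ord_recl. Qed.

Lemma disc_scons n : disc (scons x z) n.+1 = expR (- x.2) * disc z n.
Proof. by rewrite /disc -expRD -opprD [in LHS]big_ord_recl. Qed.

Lemma repaid_scons n :
  repaid (scons x z) n.+1 = x.1 + expR (- x.2) * repaid z n.
Proof.
rewrite /repaid big_ord_recl/= /disc big_ord0 oppr0 expR0 mulr1; congr (_ + _).
rewrite mulr_sumr; apply: eq_bigr => i _.
by rewrite -/(disc (scons x z) i.+1) disc_scons mulrCA.
Qed.

(** Later indices cannot contribute, as [repaid] is at least [x.1 > v] from the
    first epoch on. *)
Lemma reaches_scons_first v t : nonneg z -> 0 <= v -> v < x.1 ->
  reaches (scons x z) v t <-> v < t.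
Proof.
move=> z0 v0 vx; split=> [[[|n] []]|vt].
- by rewrite /repaid /epoch /disc !big_ord0 oppr0 expR0 divr1 addr0 add0r.
- rewrite repaid_scons => /andP[+ _]; rewrite leNgt => /negP[].
  by rewrite (lt_le_trans vx)// lerDl mulr_ge0 ?expR_ge0 ?repaid_ge0.
- exists 0%N; rewrite repaidS /repaid /epoch /disc !big_ord0 oppr0 expR0 divr1.
  by rewrite addr0 !add0r mulr1 v0 vx.
Qed.

(** The path that starts afresh after the first interval is delayed by [x.1] and
    discounted by [expR (- x.2)], so it has to cover the rest [v - x.1] of the
    level inflated by [expR x.2]. *)
Lemma reaches_scons_next v t : x.1 <= v ->
  reaches (scons x z) v t <-> reaches z (expR x.2 * (v - x.1)) (t - x.1).
Proof.
move=> xv.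
have eN : expR (- x.2) = (expR x.2)^-1 by rewrite expRN.
have e0 : 0 < expR x.2 := expR_gt0 _.
have leE n : (repaid (scons x z) n.+1 <= v) =
    (repaid z n <= expR x.2 * (v - x.1)).
  by rewrite repaid_scons eN addrC -lerBrDr [_^-1 * _]mulrC ler_pdivrMr// mulrC.
have ltE n : (v < repaid (scons x z) n.+1) =
    (expR x.2 * (v - x.1) < repaid z n).
  by rewrite !ltNge leE.
have tE n : (epoch (scons x z) n.+1 +
     (v - repaid (scons x z) n.+1) / disc (scons x z) n.+1 < t) =
    (epoch z n + (expR x.2 * (v - x.1) - repaid z n) / disc z n < t - x.1).
  rewrite ltrBrDl addrA epoch_scons repaid_scons disc_scons eN.
  congr (_ + _ < _); have d0 := disc_gt0 z n.
  by field; rewrite !gt_eqF.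
split=> [[[|n] [/andP[nv vn] nt]]|[n [/andP[nv vn] nt]]].
- move: vn; rewrite repaid_scons /repaid !big_ord0 mulr0 addr0.
  by rewrite ltNge xv.
- by exists n; rewrite -leE -ltE nv vn -tE nt.
- by exists n.+1; rewrite leE ltE nv vn tE.
Qed.

End scons.

Lemma reaches_gt0 z v t : nonneg z -> reaches z v t -> 0 < t.
Proof.
move=> z0 [n [/andP[nv _] nt]]; apply: le_lt_trans nt.
by rewrite addr_ge0 ?epoch_ge0// divr_ge0 ?subr_ge0// ltW// disc_gt0.
Qed.

(** Epochs up to the first nonzero waiting time all occur at time [0], so level
    [0] is met there without delay; if all waiting times vanish, every interval
    of the path is empty. *)
Lemma reaches0 z t : nonneg z -> 0 < t ->
  reaches z 0 t <-> exists i, (z i).1 != 0.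
Proof.
move=> z0 t0; split=> [[n [/andP[n0 nS] _]]|[i zi]].
  exists n; apply: contraTN nS => /eqP zn.
  by rewrite repaidS zn mul0r addr0 -leNgt.
have [{zi}i zi imin] := ex_minnP (ex_intro (fun i => (z i).1 != 0) i zi).
have z1 (j : 'I_i) : (z j).1 = 0.
  by apply/eqP; apply/negPn/negP => /imin; rewrite leqNgt ltn_ord.
exists i; rewrite repaidS /repaid /epoch big1; last first.
  by move=> j _; rewrite z1 mul0r.
rewrite lexx big1// subrr mul0r !add0r t0 mulr_gt0 ?disc_gt0//.
by rewrite lt_def zi z0.
Qed.

End paths.

Section hitting.
Context {d : measure_display} {T : measurableType d} {R : realType}
  {P : probability T R}.
Variables (c : R) (Z : nat -> {RV P >-> plane R}).
Hypothesis c0 : 0 < c.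
Hypothesis Z0 : forall i w, 0 <= (Z i w).1.

Let nonneg_traj w : nonneg (trajectory Z w). Proof. by move=> i; exact: Z0. Qed.

(** Monotonicity of the epochs makes the intervals disjoint, which leaves a
    single nonzero term in the series. *)
Lemma cash_flowE w n s : let z := trajectory Z w in
  epoch z n <= s < epoch z n.+1 ->
  cash_flow c Z s w = c * ((s - epoch z n) * disc z n + repaid z n).
Proof.
move=> z /andP[ns sn]; rewrite /cash_flow; congr (c * _).
rewrite (@limn_series_single _ _ n).
  rewrite indicE mem_set ?mul1r/=; last by rewrite in_itv/= ns sn.
  congr (_ + _); apply: eq_bigr => i _; congr (_ * _).
  rewrite -[renewal_time Z i.+1 w]/(epoch z i.+1).
  rewrite -[renewal_time Z i w]/(epoch z i).
  by rewrite epochS addrAC subrr add0r.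
move=> k; rewrite neq_ltn indicE => kn.
rewrite memNset ?mul0r//= in_itv/= => /andP[ks sk].
case/orP: kn => /(epoch_nd _ (nonneg_traj w)) kn.
  by have := le_lt_trans kn (le_lt_trans ns sk); rewrite ltxx.
by have := le_lt_trans kn (le_lt_trans ks sn); rewrite ltxx.
Qed.

Lemma cash_flow_eq0 w s : let z := trajectory Z w in
  (forall n, ~~ (epoch z n <= s < epoch z n.+1)) -> cash_flow c Z s w = 0.
Proof.
move=> z ns; rewrite /cash_flow (@limn_series_single _ _ 0).
  by rewrite indicE memNset ?mul0r ?mulr0//= in_itv/=; apply/negP/(ns 0%N).
move=> k _; rewrite indicE memNset ?mul0r//= in_itv/=; exact/negP/(ns k).
Qed.

(** Positivity of [u] rules out the instants beyond all epochs, where the cash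
    flow is [0]. *)
Lemma hitting_timeP u t w : 0 < u ->
  (hitting_time c Z u w < t%:E)%E <-> reaches (trajectory Z w) (u / c) t.
Proof.
move=> u0; set z := trajectory Z w; have c1 : c != 0 by rewrite gt_eqF.
split.
  move=> /ereal_inf_lt[_ [s [s0 su] <-]]; rewrite lte_fin => st.
  have [[n nsn]|ns] := pselect (exists n, epoch z n <= s < epoch z n.+1);
      last first.
    move: su; rewrite cash_flow_eq0; first by move=> uE; rewrite -uE ltxx in u0.
    by move=> n; apply/negP => nsn; apply: ns; exists n.
  have d0 := disc_gt0 z n.
  have uE : u / c = (s - epoch z n) * disc z n + repaid z n.
    by rewrite -su (cash_flowE _ _ _ nsn) mulrAC mulfV// mul1r.
  move/andP: nsn => [ns sn]; exists n; rewrite uE addrK mulfK ?gt_eqF//.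
  rewrite [_ + (s - _)]addrC subrK; split=> //; rewrite lerDr repaidS.
  rewrite mulr_ge0 ?subr_ge0 ?(ltW d0)//= addrC ltrD2l ltr_pM2r//.
  by rewrite ltrBlDl -epochS.
move=> [n [/andP[nu un] nt]]; have d0 := disc_gt0 z n.
set s := epoch z n + _ in nt.
have ns : epoch z n <= s by rewrite lerDl divr_ge0 ?subr_ge0// ltW.
have sn : s < epoch z n.+1.
  by rewrite epochS ltrD2l ltr_pdivrMr// ltrBlDl -repaidS.
rewrite (@le_lt_trans _ _ s%:E) ?lte_fin//; apply: ereal_inf_lbound.
exists s => //; split.
  by rewrite (le_trans _ ns)// epoch_ge0//; exact: nonneg_traj.
rewrite (@cash_flowE _ n) ?ns//= -/z /s [epoch z n + _]addrC addrK.
rewrite divfK ?gt_eqF//.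
by rewrite subrK mulrCA mulfV ?mulr1.
Qed.

End hitting.

(** * Measurability of the repayment event *)

Section reaches_measurable.
Context {R : realType}.
Local Notation S := (seqspace (plane R)).

Lemma measurable_epoch n : measurable_fun setT (fun z : S => epoch z n).
Proof.
apply: measurable_sum => i; apply: (measurableT_comp measurable_fst).
exact: measurable_fun_coord.
Qed.

Lemma measurable_rate n :
  measurable_fun setT (fun z : S => \sum_(i < n) (z i).2).
Proof.
apply: measurable_sum => i; apply: (measurableT_comp measurable_snd).
exact: measurable_fun_coord.
Qed.

Lemma measurable_disc n : measurable_fun setT (fun z : S => disc z n).
Proof.
apply: (measurableT_comp (@measurable_expR R)); apply: measurable_funN.
exact: measurable_rate.
Qed.

Lemma measurable_repaid n : measurable_fun setT (fun z : S => repaid z n).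
Proof.
apply: measurable_sum => i; apply: measurable_funM; last exact: measurable_disc.
apply: (measurableT_comp measurable_fst); exact: measurable_fun_coord.
Qed.

(** Joint measurability in level, time and path: it yields measurability of the
    sections and, by integration over the path, of the repayment probability in
    level and time. *)
Lemma measurable_reaches :
  measurable [set p : plane R * S | reaches p.2 p.1.1 p.1.2].
Proof.
have mv : measurable_fun setT (fun p : plane R * S => p.1.1 : R).
  exact: (measurableT_comp measurable_fst measurable_fst).
have mt : measurable_fun setT (fun p : plane R * S => p.1.2 : R).
  exact: (measurableT_comp measurable_snd measurable_fst).
have mz (f : S -> R) : measurable_fun setT f ->
    measurable_fun setT (fun p : plane R * S => f p.2).
  by move=> mf; exact: (measurableT_comp mf measurable_snd).
(* division by [disc] is rewritten as a product with an exponential *)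
rewrite (_ : [set p | _] = \bigcup_n
  ((fun p : plane R * S => (repaid p.2 n <= p.1.1) && (p.1.1 < repaid p.2 n.+1)
     && (epoch p.2 n + (p.1.1 - repaid p.2 n) *
         expR (\sum_(i < n) (p.2 i).2) < p.1.2)) @^-1` [set true])); last first.
  apply/seteqP; split=> [p [n []]|p [n _ /=]].
    rewrite /disc expRN invrK => rv tp; exists n => //=; exact/andP.
  by move=> /andP[rv tp]; exists n; split=> //; rewrite /disc expRN invrK.
apply: bigcupT_measurable => n; rewrite -[X in measurable X]setTI.
suff : measurable_fun setT (fun p : plane R * S =>
   (repaid p.2 n <= p.1.1) && (p.1.1 < repaid p.2 n.+1)
     && (epoch p.2 n + (p.1.1 - repaid p.2 n) *
         expR (\sum_(i < n) (p.2 i).2) < p.1.2)) by apply.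
apply: measurable_and; first apply: measurable_and.
- by apply: measurable_fun_ler => //; exact: mz (measurable_repaid n).
- by apply: measurable_fun_ltr => //; exact: mz (measurable_repaid n.+1).
- apply: measurable_fun_ltr => //; apply: measurable_funD.
    exact: mz (measurable_epoch n).
  apply: measurable_funM; last first.
    apply: (measurableT_comp (@measurable_expR R)).
    exact: mz (measurable_rate n).
  by apply: measurable_funB => //; exact: mz (measurable_repaid n).
Qed.

Lemma measurable_reaches_at v t : measurable [set z : S | reaches z v t].
Proof.
rewrite (_ : [set z | _] =
    xsection [set p : plane R * S | reaches p.2 p.1.1 p.1.2] (v, t)).
  apply: measurable_xsection; exact: measurable_reaches.
by apply/seteqP; split=> z; rewrite /xsection/= inE.
Qed.

Definition never_moves : set (nat -> plane R) :=
  [set z | forall i, (z i).1 = 0].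

Lemma measurable_never_moves : measurable (never_moves : set S).
Proof.
rewrite (_ : never_moves = \bigcap_i ((fun z : S => (z i).1) @^-1` [set 0])).
  apply: bigcapT_measurable => i; rewrite -[X in measurable X]setTI.
  have : measurable_fun setT (fun z : S => (z i).1 : R).
    apply: (measurableT_comp measurable_fst); exact: measurable_fun_coord.
  by apply.
by apply/seteqP; split=> [z z0 i _|z z0 i]; [exact: z0|exact: (z0 i I)].
Qed.

End reaches_measurable.

(** * First-step decomposition *)

Section renewal_equation.
Context {d : measure_display} {T : measurableType d} {R : realType}
  {P : probability T R} {c : R} {WX : {RV P >-> plane R}}
  {Z : nat -> {RV P >-> plane R}}.
Hypothesis c_gt0 : 0 < c.
Hypothesis WX_ge0 : forall w, 0 <= (WX w).1.
Hypothesis Z_ge0 : forall i w, 0 <= (Z i w).1.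
Hypothesis iid : iid_copies WX Z.

Local Notation nu := (distribution P (trajectory Z)).

Let mWX1 : measurable_fun setT (fun w => (WX w).1 : R).
Proof. exact: (measurableT_comp measurable_fst (measurable_funPT WX)). Qed.

Let mWX2 : measurable_fun setT (fun w => (WX w).2 : R).
Proof. exact: (measurableT_comp measurable_snd (measurable_funPT WX)). Qed.

Let nu_fin v t : nu [set z | reaches z v t] \is a fin_num.
Proof. by apply: fin_num_measure; exact: measurable_reaches_at. Qed.

(** Extends [psi], with the level divided by [c], to a function that is
    measurable on the whole plane. *)
Let reach_prob (v t : R) : R := fine (nu [set z | reaches z v t]).

Lemma measurable_reach_prob :
  measurable_fun setT (fun p : plane R => reach_prob p.1 p.2).
Proof.
have := @measurable_fun_xsection _ _ (plane R) (seqspace (plane R)) R nu _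
  measurable_reaches.
move=> /(measurableT_comp (fine_measurable measurableT)).
apply: eq_measurable_fun => p _ /=; congr (fine (nu _)).
by apply/seteqP; split=> z; rewrite /xsection/= inE.
Qed.

Lemma psiE u t : 0 < u -> psi c Z u t = reach_prob (u / c) t.
Proof.
move=> u0; rewrite /psi /reach_prob; congr (fine (P _)).
by apply/seteqP; split=> w /= /hitting_timeP; apply.
Qed.

Lemma bounded_measurable_psi : bounded_measurable (psi c Z).
Proof.
split; last first.
  exists 1 => u t u0 t0; rewrite psiE// ger0_norm ?fine_ge0//.
  rewrite -lee_fin fineK ?nu_fin//; apply: probability_le1.
  exact: measurable_reaches_at.
have mc : measurable_fun setT (fun p : plane R => (p.1 / c, p.2) : plane R).
  apply: measurable_fun_pair; last exact: measurable_snd.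
  by apply: measurable_funM => //; exact: measurable_fst.
apply: (eq_measurable_fun
  (fun p : plane R => reach_prob (p.1 / c) p.2 : measurableTypeR R)).
  move=> p; rewrite inE => -[/=]; rewrite !in_itv/= !andbT => u0 _.
  by rewrite psiE.
apply: measurable_funTS.
exact: (measurableT_comp measurable_reach_prob mc).
Qed.

Let no_wait : set T := [set w | (WX w).1 = 0].

Let measurable_no_wait : measurable no_wait.
Proof.
by have := mWX1 measurableT [set 0] (measurable_set1 _); rewrite setTI.
Qed.

(** The waiting times all vanish if and only if the first one does and the tail
    never moves. *)
Lemma never_moves_fixpoint :
  nu never_moves = (nu never_moves * P no_wait)%E.
Proof.
rewrite [LHS](law_scons Z iid never_moves measurable_never_moves).
rewrite -[in RHS](setIT no_wait) -integral_indic//.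
rewrite -ge0_integralZl//; first last.
- exact/measurable_EFinP/measurable_indic.
apply: eq_integral => w _; rewrite indicE.
have [W0|W0] := eqVneq (WX w).1 0.
  rewrite mem_set// mule1; congr (nu _); apply/seteqP; split=> z zN i.
    exact: (zN i.+1).
  by case: i.
rewrite memNset ?mule0; last exact/eqP.
rewrite (_ : [set z | _] = set0) ?measure0//.
by apply/seteqP; split=> // z /(_ 0%N) /= /eqP; rewrite (negPf W0).
Qed.

(** If the fixpoint equation has a nonzero solution, then the factor
    [P no_wait] is [1], and the waiting time almost surely avoids [v > 0]. *)
Lemma ae_never_moves (v : R) : 0 < v -> {ae P, forall w, (WX w).1 = v ->
  nu never_moves = 0%E}.
Proof.
move=> v0; have := never_moves_fixpoint.
set q := nu _ => qE; have [q0|q0] := eqVneq q 0%E; first exact/aeW.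
have p1 : P no_wait = 1%E.
  have qf : q \is a fin_num.
    by apply: fin_num_measure; exact: measurable_never_moves.
  have pf : P no_wait \is a fin_num by exact: fin_num_measure.
  move: qE q0; rewrite -(fineK qf) -(fineK pf) -EFinM eqe => -[qE q0].
  by congr EFin; apply: (mulfI q0); rewrite -qE mulr1.
exists (~` no_wait); split; first exact: measurableC.
  by rewrite probability_setC// p1 subee.
apply: subsetC => w W0 /= Wv; move: v0.
by rewrite -Wv (W0 : (WX w).1 = 0) ltxx.
Qed.

(** The integrand of the renewal equation, according to the position of the
    first waiting time with respect to the level.  When the two coincide, the
    shifted path is left with level [0], which it reaches unless it never
    moves; the hypothesis on [never_moves] makes this exception negligible. *)
Lemma first_step u t w : 0 < u ->
  ((WX w).1 = u / c -> nu never_moves = 0%E) ->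
  nu [set z | reaches (scons (WX w) z) (u / c) t] =
  ((u / c <= (WX w).1)%R%:R * (u / c < t)%R%:R +
   ((WX w).1 < Num.min t (u / c))%R%:R *
     psi c Z (expR (WX w).2 * (u - c * (WX w).1)) (t - (WX w).1))%:E.
Proof.
move=> u0 q0; set x := WX w; have x0 : 0 <= x.1 by exact: WX_ge0.
have Zn w' : nonneg (trajectory Z w') by move=> i; exact: Z_ge0.
have nuE (A : set (nat -> plane R)) (Q : set T) :
    (forall w', A (trajectory Z w') <-> Q w') -> nu A = P Q.
  by move=> AQ; congr (P _); apply/seteqP; split=> w' /AQ.
have PT (b : bool) : P [set _ | b] = b%:R%:E.
  case: b.
    rewrite (_ : [set _ | _] = setT) ?probability_setT//.
    by apply/seteqP; split.
  by rewrite (_ : [set _ | _] = set0) ?measure0//; apply/seteqP; split.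
have [vx|xv|vx] := ltgtP (u / c) x.1.
- rewrite lt_min [x.1 < u / c]ltNge (ltW vx) andbF mul0r addr0 mul1r -PT.
  have v0 : 0 <= u / c by rewrite divr_ge0 ?ltW.
  apply: nuE => w' /=; exact: reaches_scons_first _ _ _ _ (Zn w') v0 vx.
- rewrite mul0r add0r lt_min xv andbT.
  have u'0 : 0 < expR x.2 * (u - c * x.1).
    by rewrite mulr_gt0 ?expR_gt0// subr_gt0 mulrC -ltr_pdivlMr.
  have v'E : expR x.2 * (u / c - x.1) = expR x.2 * (u - c * x.1) / c.
    by field; rewrite gt_eqF.
  have [xt|tx] := ltP x.1 t.
    rewrite mul1r psiE// fineK ?nu_fin//.
    apply: nuE => w'; rewrite -v'E; apply: reaches_scons_next; exact: ltW.
  rewrite mul0r -(PT false); apply: nuE => w'.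
  split=> // /(reaches_scons_next _ _ _ _ (ltW xv))/(reaches_gt0 _ _ _ (Zn _)).
  by rewrite subr_gt0 ltNge tx.
- rewrite lt_min vx ltxx andbF mul0r addr0 mul1r.
  have [vt|tv] := ltP x.1 t; last first.
    rewrite -(PT false); apply: nuE => w'; split=> //.
    move=> /(reaches_scons_next _ _ _ _ (lexx _))/(reaches_gt0 _ _ _ (Zn _)).
    by rewrite subr_gt0 ltNge tv.
  have mN := @measurable_never_moves R.
  transitivity (nu (~` never_moves)); last first.
    transitivity (1 - nu never_moves)%E; last by rewrite q0// sube0.
    exact: (@probability_setC _ _ _ nu).
  apply: nuE => w' /=.
  rewrite (reaches_scons_next _ _ _ _ (lexx _)) subrr mulr0.
  rewrite reaches0 ?subr_gt0//; split=> [[i /eqP zi] /(_ i)//|].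
  by move=> /existsNP[i /eqP zi]; exists i.
Qed.

Lemma renewal_equation u t : 0 < u ->
  (psi c Z u t)%:E = ((psi0 c WX u t)%:E + Kop c WX (psi c Z) u t)%E.
Proof.
move=> u0; have v0 : 0 < u / c by rewrite divr_gt0.
pose f w : R := (u / c <= (WX w).1)%R%:R * (u / c < t)%R%:R.
pose g w : R := ((WX w).1 < Num.min t (u / c))%R%:R *
     psi c Z (expR (WX w).2 * (u - c * (WX w).1)) (t - (WX w).1).
have mWge : measurable [set w | u / c <= (WX w).1].
  rewrite -[X in measurable X]setTI.
  suff : measurable_fun setT (fun w => u / c <= (WX w).1) by apply.
  exact: measurable_fun_ler.
have fE : f = fun w => (u / c < t)%R%:R * \1_[set w | u / c <= (WX w).1] w.
  apply/funext => w; rewrite /f mulrC indicE; congr (_ * _%:R).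
  have [vW|Wv] := leP (u / c) (WX w).1; first by rewrite mem_set.
  by rewrite memNset//=; apply/negP; rewrite -ltNge.
have mf : measurable_fun setT (EFin \o f).
  apply/measurable_EFinP; rewrite fE; exact: measurable_funM.
have mg : measurable_fun setT (EFin \o g).
  apply/measurable_EFinP; rewrite (_ : g = fun w =>
     if (WX w).1 < Num.min t (u / c) then
       reach_prob (expR (WX w).2 * (u - c * (WX w).1) / c) (t - (WX w).1)
     else 0); last first.
    apply/funext => w; rewrite /g; case: ifPn; rewrite ?mul0r// mul1r.
    rewrite lt_min => /andP[_ xv]; apply: psiE.
    by rewrite mulr_gt0 ?expR_gt0// subr_gt0 mulrC -ltr_pdivlMr.
  apply: measurable_fun_if => //.
  - exact: measurable_fun_ltr.
  - apply: measurable_funTS.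
    have mp : measurable_fun setT (fun w =>
        (expR (WX w).2 * (u - c * (WX w).1) / c, t - (WX w).1) : plane R).
      apply: measurable_fun_pair; last exact: measurable_funB.
      apply: measurable_funM => //; apply: measurable_funM.
        exact: measurableT_comp.
      by apply: measurable_funB => //; exact: measurable_funM.
    exact: (measurableT_comp measurable_reach_prob mp).
have g0 w : 0 <= g w by rewrite mulr_ge0 ?fine_ge0.
transitivity (\int[P]_w ((f w)%:E + (g w)%:E))%E.
  rewrite psiE// fineK ?nu_fin//.
  rewrite [LHS](law_scons Z iid _ (measurable_reaches_at _ _)).
  apply: ae_eq_integral => //.
  - have mA := measurable_law_scons Z _ (measurable_reaches_at (u / c) t).
    exact: (measurableT_comp mA (measurable_funPT WX)).
  - exact: emeasurable_funD.
  - apply: filterS (ae_never_moves _ v0) => w q0 _.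
    by rewrite -EFinD; exact: first_step.
rewrite ge0_integralD//; first last.
- by move=> w _; rewrite lee_fin g0.
- by move=> w _; rewrite lee_fin mulr_ge0.
congr (_ + _)%E; last by rewrite /Kop unlock.
rewrite fE; under eq_integral do rewrite EFinM.
rewrite ge0_integralZl//; last first.
  exact/measurable_EFinP/measurable_indic.
rewrite integral_indic// setIT /psi0 EFinM fineK ?fin_num_measure//.
by rewrite muleC.
Qed.

End renewal_equation.

Theorem corollary2p2 (R : realType) (d : measure_display)
    (T : measurableType d) (P : probability T R) (c : R)
    (WX : {RV P >-> plane R}) (Z : nat -> {RV P >-> plane R})
    (hc : 0 < c)
    (hWX : forall w, 0 <= (WX w).1 /\ 0 < (WX w).2)
    (hZ : forall i w, 0 <= (Z i w).1 /\ 0 < (Z i w).2)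
    (hiid : iid_copies WX Z) :
  bounded_measurable (psi c Z) /\
  forall u t : R, 0 < u -> 0 < t ->
    (psi c Z u t)%:E = ((psi0 c WX u t)%:E + Kop c WX (psi c Z) u t)%E.
Proof.
have W0 w : 0 <= (WX w).1 by have [] := hWX w.
have Z0 i w : 0 <= (Z i w).1 by have [] := hZ i w.
split; first exact: bounded_measurable_psi.
move=> u t u0 _; exact: renewal_equation.
Qed.
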